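(* Let $S=\{(d/p)_G : G \text{ a finite digraph with at least one vertex}\}$. Then $S$ is dense in the interval $[0,1/2]$; that is, for every $r\in[0,1/2]$ and every $\varepsilon>0$ there is a finite digraph $G$ with $|(d/p)_G - r|<\varepsilon$.
   Context: Digraphs are finite, with no loops. A permutation in a digraph $G=(V,E)$ is a bijection $f:V\to V$ such that for every $v\in V$ either $f(v)=v$ or $(v,f(v))\in E$. A derangement in $G$ is a permutation of $G$ that fixes no vertex. $(d/p)_G$ denotes the number of derangements of $G$ divided by the number of permutations of $G$ (the identity is always a permutation, so this is well defined). *)

(* Defs.v *)
From mathcomp Require Import all_boot all_order all_algebra all_fingroup.
Set Implicit Arguments. Unset Strict Implicit. Unset Printing Implicit Defensive.
Import Order.TTheory GRing.Theory Num.Theory.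

(* A finite digraph on vertex type T : finType is an edge relation E : rel T
   with no loops (irreflexive). *)
Definition loopless (T : finType) (E : rel T) : Prop := forall v, ~~ E v v.

Definition is_graph_perm (T : finType) (E : rel T) (f : {perm T}) : bool :=
  [forall v, (f v == v) || E v (f v)].

Definition is_graph_derangement (T : finType) (E : rel T) (f : {perm T}) : bool :=
  is_graph_perm E f && [forall v, f v != v].

Definition num_perms (T : finType) (E : rel T) : nat :=
  #|[set f : {perm T} | is_graph_perm E f]|.

Definition num_derangements (T : finType) (E : rel T) : nat :=
  #|[set f : {perm T} | is_graph_derangement E f]|.

Definition dp_ratio (R : numFieldType) (T : finType) (E : rel T) : R :=
  (num_derangements E)%:R / (num_perms E)%:R.

(* Main.v *)
Require Import Defs.
From mathcomp Require Import all_boot all_order all_algebra all_fingroup.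
From mathcomp Require Import reals ring lra zify.
Set Implicit Arguments. Unset Strict Implicit. Unset Printing Implicit Defensive.
Import Order.TTheory GRing.Theory Num.Theory.

(** Arrange layers of k vertices in a directed cycle, with all edges from each
    layer to the next, except that m of the transitions lack one edge. A
    permutation moves the same number j of vertices in every layer. For each
    transition the weight for j = k - 1 is 1 or 1 + 1/(k(k-1)) times the weight
    for j = k, according to whether the transition is complete or defective,
    while for j <= k - 2 it is at most half of it. Hence, as the number of layers
    grows, the ratio tends to 1 / (1 + (1 + 1/(k(k-1)))^m), and these numbers are
    dense in [0, 1/2]. To make the count factor over transitions, the
    transitions are taken in pairs, the second one of each pair being complete. *)

(** * Permutations of digraphs whose edges lead from each layer to the next *)

Local Open Scope nat_scope.

(* The functions [g] stand for bijections from [S] to [T]; being the identity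
   outside [S] only makes the encoding unique. *)
Definition part_bij (K : finType) (b : rel K) (S T : {set K}) : {set {ffun K -> K}} :=
  [set g : {ffun K -> K} | [&& [forall x, if x \in S then b x (g x) else g x == x],
                 g @: S == T & #|S| == #|T|]].

Lemma part_bijP (K : finType) (b : rel K) (S T : {set K}) (g : {ffun K -> K}) :
  reflect [/\ forall x, x \in S -> b x (g x), forall x, x \notin S -> g x = x,
              {in S &, injective g} & g @: S = T] (g \in part_bij b S T).
Proof.
rewrite inE; apply: (iffP and3P) => [[/forallP h /eqP <- c]|[h1 h2 h3 <-]].
  split => // [x xS|x /negPf xS|]; first by have := h x; rewrite xS.
    by have := h x; rewrite xS => /eqP.
  by apply/imset_injP; rewrite eq_sym.
rewrite eqxx eq_sym; split=> //; last exact/imset_injP.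
apply/forallP => x; case: ifPn => [/h1 //|/h2 ->]; exact: eqxx.
Qed.

Definition cyc_rel (I K : finType) (s : I -> I) (b : I -> rel K) : rel (I * K) :=
  fun u v => (v.1 == s u.1) && b u.1 u.2 v.2.

Definition moved_sets (I K : finType) (f : {perm I * K}) : {ffun I -> {set K}} :=
  [ffun i => [set x | f (i, x) != (i, x)]].

(** A moved vertex goes to the next layer, and the moved vertices of layer [s i] are exactly the
    images of those of layer [i]. So a permutation with moved sets [M] amounts to independent
    choices, one for each [i], of a bijection from [M i] to [M (s i)] along [b i]. *)
Lemma card_moved (I K : finType) (s : I -> I) (b : I -> rel K)
    (M : {ffun I -> {set K}}) :
  injective s -> (forall i, s i != i) ->
  #|[set f : {perm I * K} | is_graph_perm (cyc_rel s b) f & moved_sets f == M]| =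
  \prod_i #|part_bij (b i) (M i) (M (s i))|.
Proof.
move=> s_inj s_fix.
have -> : \prod_i #|part_bij (b i) (M i) (M (s i))| =
   #|family (fun i => mem (part_bij (b i) (M i) (M (s i))))|.
  by rewrite card_family foldrE big_map big_enum.
set D := [set f | _ & _].
pose phi (f : {perm I * K}) : {ffun I -> {ffun K -> K}} :=
  [ffun i => [ffun x => (f (i, x)).2]].
have fE f : f \in D -> forall i x,
   f (i, x) = if x \in M i then (s i, phi f i x) else (i, x).
  rewrite inE => /andP[/forallP Gf /eqP <-] i x; rewrite !ffunE !inE.
  case: ifPn => [|/negPn/eqP->] //.
  have := Gf (i, x); case: (f (i, x) =P (i, x)) => //= _ /andP[/eqP/= <- _] _.
  by case: (f _).
have fM f : f \in D -> forall i x, (x \in M i) = (f (i, x) != (i, x)).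
  by rewrite inE => /andP[_ /eqP <-] i x; rewrite ffunE inE.
have phi_inj : {in D &, injective phi}.
  move=> f g fD gD e; apply/permP => -[i x].
  by rewrite fE // (fE g) // e.
rewrite -(card_in_imset phi_inj); apply: eq_card => g.
apply/imsetP/familyP => [[f fD ->] i|Hg].
  apply/part_bijP; split => [x xM|x xM|x y xM yM e|].
  - have := fD; rewrite inE => /andP[/forallP/(_ (i, x)) + _].
    have := fM f fD i x; rewrite xM => /esym/negPf -> /= /andP[_].
    by rewrite !ffunE.
  - by rewrite !ffunE fE // (negPf xM).
  - suff: (i, x) = (i, y) by case.
    by apply: (@perm_inj _ f); rewrite !fE // xM yM e.
  - apply/setP => y; apply/imsetP/idP => [[x xM ->]|yM].
      (* Were the image fixed, it would have two preimages, itself and [(i, x)], in different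
         layers. *)
      rewrite (fM f fD); apply/eqP => e.
      have e2: f (i, x) = (s i, phi f i x) by rewrite fE // xM.
      have: f (i, x) = f (s i, phi f i x) by rewrite e.
      by move/perm_inj => -[e3]; have := s_fix i; rewrite -e3 eqxx.
    pose z := (f^-1)%g (s i, y).
    have fz : f z = (s i, y) by rewrite /z permKV.
    clearbody z; case: z fz => i' x.
    rewrite fE //; case: ifPn => [xM [/s_inj e1 e2]|xM [e1 e2]].
      by subst i'; exists x.
    by move: xM; rewrite e1 e2 yM.
pose F (u : I * K) := if u.2 \in M u.1 then (s u.1, g u.1 u.2) else u.
have gM i x : x \in M i -> g i x \in M (s i).
  move=> xM; have /part_bijP[_ _ _ <-] := Hg i; exact: imset_f.
have F_inj : injective F.
  move=> [i x] [j y]; rewrite /F /=.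
  case: ifPn => xM; case: ifPn => yM //.
  - case=> /s_inj e; subst j => e; congr pair.
    by have /part_bijP[_ _ h _] := Hg i; apply: h.
  - by case=> e1 e2; move: yM; rewrite -e1 -e2 gM.
  - by case=> e1 e2; move: xM; rewrite e1 e2 gM.
have pE u : perm F_inj u = F u by rewrite permE.
exists (perm F_inj); last first.
  apply/ffunP => i; apply/ffunP => x; rewrite !ffunE pE /F /=.
  by case: ifPn => //= xM; have /part_bijP[_ h _ _] := Hg i; rewrite h.
have FM i x : (F (i, x) != (i, x)) = (x \in M i).
  rewrite /F /=; case: ifPn; rewrite ?eqxx // => _.
  by apply/eqP => -[e _]; have := s_fix i; rewrite e eqxx.
rewrite inE; apply/andP; split.
  apply/forallP => -[i x]; rewrite pE; have := FM i x.
  case: (F (i, x) =P (i, x)) => //= _ /esym xM.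
  rewrite /cyc_rel /F /= xM /= eqxx /=.
  by have /part_bijP[h _ _ _] := Hg i; apply: h.
by apply/eqP/ffunP => i; apply/setP => x; rewrite ffunE inE pE FM.
Qed.

Lemma num_perms_cyc (I K : finType) (s : I -> I) (b : I -> rel K) :
  injective s -> (forall i, s i != i) ->
  num_perms (cyc_rel s b) =
  \sum_(M : {ffun I -> {set K}}) \prod_i #|part_bij (b i) (M i) (M (s i))|.
Proof.
move=> s_inj s_fix; rewrite /num_perms -sum1_card.
rewrite (partition_big (@moved_sets I K) predT) //=.
apply: eq_bigr => M _; rewrite -card_moved // -sum1_card.
by apply: eq_bigl => f; rewrite !inE.
Qed.

(** Derangements are the permutations whose moved sets are all of [K]: one term of the sum for
    [num_perms]. *)
Lemma num_derangements_cyc (I K : finType) (s : I -> I) (b : I -> rel K) :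
  injective s -> (forall i, s i != i) ->
  num_derangements (cyc_rel s b) = \prod_i #|part_bij (b i) setT setT|.
Proof.
move=> s_inj s_fix.
transitivity (\prod_i #|part_bij (b i) ([ffun=> setT] i) ([ffun=> setT] (s i))|).
  rewrite -(card_moved b [ffun=> setT]) //.
  apply: eq_card => f; rewrite !inE /is_graph_derangement; congr (_ && _).
  apply/forallP/eqP => [h|h [i x]].
    by apply/ffunP => i; apply/setP => x; rewrite !ffunE !inE h.
  have := congr1 (fun m : {ffun I -> {set K}} => x \in m i) h.
  by rewrite !ffunE !inE.
by apply: eq_bigr => i _; rewrite !ffunE.
Qed.

(** * Bijections between subsets, unrestricted or with one pair forbidden *)

Lemma card_part_bij_full (K : finType) (S T : {set K}) :
  #|part_bij (fun _ _ => true) S T| = if #|S| == #|T| then #|S|`! else 0.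
Proof.
case: ifPn => [/eqP eST|neST]; last first.
  by apply: eq_card0 => g; rewrite inE (negPf neST) !andbF.
rewrite -ffactnn {1}eST -[X in _ ^_ X](card_sig (mem S)) -card_inj_ffuns_on.
pose phi (g : {ffun K -> K}) : {ffun {x | x \in S} -> K} := [ffun x => g (val x)].
have phi_inj : {in part_bij (fun _ _ => true) S T &, injective phi}.
  move=> g h /part_bijP[_ g2 _ _] /part_bijP[_ h2 _ _] e; apply/ffunP => x.
  have [xS|xS] := boolP (x \in S); last by rewrite g2 ?h2.
  by have /ffunP/(_ (exist _ x xS)) := e; rewrite !ffunE.
rewrite -(card_in_imset phi_inj); apply: eq_card => h; rewrite inE.
apply/imsetP/andP => [[g /part_bijP[_ _ g3 <-] ->]|[/ffun_onP h1 /injectiveP h2]].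
  split; first by apply/ffun_onP => x; rewrite ffunE; apply: imset_f; apply: valP.
  by apply/injectiveP => x y; rewrite !ffunE => /g3 e; apply/val_inj/e; apply: valP.
pose g : {ffun K -> K} := [ffun x => if insub x is Some u then h u else x].
have gE (u : {x | x \in S}) : g (val u) = h u by rewrite ffunE valK.
exists g; last by apply/ffunP => u; rewrite ffunE gE.
have g3 : {in S &, injective g}.
  move=> x y xS yS; rewrite (gE (exist _ x xS)) (gE (exist _ y yS)).
  by move/h2 => [].
apply/part_bijP; split=> // [x xS|]; first by rewrite ffunE insubN.
apply/eqP; rewrite eqEcard (card_in_imset g3) eST leqnn andbT.
by apply/subsetP => _ /imsetP[x xS ->]; rewrite (gE (exist _ x xS)).
Qed.

Definition avoid (K : finType) (z : K) : rel K := fun x y => ~~ ((x == z) && (y == z)).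

(* A bijection from [S] to [T] using the missing edge [(z, z)] is, as a function,
   literally an element of [part_bij] for [S :\ z] and [T :\ z]. *)
Lemma card_part_bij_avoid (K : finType) (z : K) (S T : {set K}) :
  #|part_bij (avoid z) S T| + (if (z \in S) && (z \in T) then
      #|part_bij (fun _ _ => true) (S :\ z) (T :\ z)| else 0) =
  #|part_bij (fun _ _ => true) S T|.
Proof.
pose Z := [set g : {ffun K -> K} | (z \in S) && (g z == z)].
rewrite -[RHS](cardsID Z) addnC; congr (_ + _); last first.
  apply: eq_card => g; rewrite !inE.
  case: (_ == T); case: (_ == #|T|); rewrite /= ?andbF // !andbT.
  apply/forallP/andP => [h|[h1 /forallP h2] x].
    split.
      by have := h z; rewrite /avoid; case: ifP => //; rewrite eqxx.
    by apply/forallP => x; have := h x; case: ifP.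
  have := h2 x; case: ifP => // xS _; rewrite /avoid.
  by case: eqP => // e; move: h1; rewrite -e xS.
case: ifPn => [/andP[zS zT]|]; last first.
  move=> nz; apply/esym/eq_card0 => g; rewrite inE; apply/negbTE/negP.
  move=> /andP[/part_bijP[_ _ _ gT]]; rewrite inE => /andP[zS /eqP gz].
  by move: nz; rewrite zS -gT -gz imset_f.
apply: eq_card => g; rewrite [RHS]inE [in X in _ && X]inE zS /=.
apply/part_bijP/andP => [[_ g2 g3 g4]|[/part_bijP[_ g2 g3 g4] /eqP gz]].
  have gz : g z = z by apply: g2; rewrite !inE eqxx.
  split; last exact/eqP.
  have gS x : x \in S -> x != z -> g x \in T :\ z.
    by move=> xS xz; rewrite -g4 imset_f // !inE xz.
  apply/part_bijP; split => //.
  - by move=> x xS; apply: g2; rewrite !inE (negPf xS) andbF.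
  - move=> x y xS yS; case: (x =P z) => [->|/eqP xz]; case: (y =P z) => [->|/eqP yz] //.
    + by rewrite gz => e; have := gS y yS yz; rewrite -e !inE eqxx.
    + by rewrite gz => e; have := gS x xS xz; rewrite e !inE eqxx.
    + by apply: g3; rewrite !inE ?xz ?yz.
  - by rewrite -(setD1K zS) imsetU1 g4 gz setD1K.
split => //.
- move=> x; rewrite !inE negb_and negbK => /orP[/eqP -> //|]; exact: g2.
- by move=> x y; rewrite !inE => /andP[_ xS] /andP[_ yS]; apply: g3.
- apply/setP => y; rewrite !inE -g4; apply/imsetP/andP => [[x] |[yz /imsetP[x xS e]]].
    rewrite !inE => /andP[xz xS] ->; split; last exact: imset_f.
    by apply: contra xz => /eqP; rewrite -[X in _ = X]gz => /g3 -> //.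
  by exists x => //; rewrite !inE xS andbT; apply: contra yz => /eqP xz; rewrite e xz gz.
Qed.

(** * Cycles of layers in which every second transition is complete *)

Definition layer_next (n : nat) (i : 'I_n.+1 * bool) : 'I_n.+1 * bool :=
  if i.2 then (ordS i.1, false) else (i.1, true).

Lemma layer_next_inj (n : nat) : injective (@layer_next n).
Proof.
move=> [i a] [j c] e.
have := congr1 snd e; have := congr1 fst e; rewrite /layer_next {e}.
by case: a; case: c => //= e1 _; [rewrite (ordS_inj e1)|rewrite e1].
Qed.

Lemma layer_next_neq (n : nat) (i : 'I_n.+1 * bool) : layer_next i != i.
Proof. by case: i => i [] /=; rewrite /layer_next xpair_eqE andbF. Qed.

Definition layer_rel (n : nat) (K : finType) (b : 'I_n.+1 -> rel K) :
    'I_n.+1 * bool -> rel K :=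
  fun i x y => i.2 || b i.1 x y.

(** This counts the matchings with [j] edges in the bipartite graph of [b] between two copies of
    [K]. *)
Definition num_part_bij (K : finType) (b : rel K) (j : nat) : nat :=
  \sum_(S : {set K} | #|S| == j) \sum_(T : {set K} | #|T| == j) #|part_bij b S T|.

Lemma big_ffun_bool (L X : finType) (G : L -> X -> X -> nat) :
  \sum_(M : {ffun L * bool -> X}) \prod_t G t (M (t, false)) (M (t, true)) =
  \prod_t \sum_x \sum_y G t x y.
Proof.
under [RHS]eq_bigr => t _ do rewrite pair_bigA /=.
rewrite bigA_distr_bigA /=.
pose h (P : {ffun L -> X * X}) : {ffun L * bool -> X} :=
  [ffun i => if i.2 then (P i.1).2 else (P i.1).1].
pose h' (M : {ffun L * bool -> X}) : {ffun L -> X * X} :=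
  [ffun t => (M (t, false), M (t, true))].
have hK : cancel h h' by move=> P; apply/ffunP => t; rewrite !ffunE; case: (P t).
have h'K : cancel h' h by move=> M; apply/ffunP => -[t []]; rewrite !ffunE.
rewrite (reindex h); last by exists h' => ? _; rewrite ?hK ?h'K.
by apply: eq_bigr => P _; apply: eq_bigr => t _; rewrite !ffunE.
Qed.

Lemma part_bij_card (K : finType) (b : rel K) (S T : {set K}) :
  0 < #|part_bij b S T| -> #|S| = #|T|.
Proof. by case/card_gt0P => g; rewrite inE => /and3P[_ _ /eqP]. Qed.

(** Bijections preserve size, so all moved sets around the cycle have one size [j]. A complete
    transition then contributes the factorial of [j] whatever the sets are, so different [t] share
    no further constraint and the sum factors. *)
Lemma num_perms_layer (n : nat) (K : finType) (b : 'I_n.+1 -> rel K) :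
  num_perms (cyc_rel (@layer_next n) (layer_rel b)) =
  \sum_(j < #|K|.+1) \prod_t (j`! * num_part_bij (b t) j).
Proof.
rewrite num_perms_cyc; [|exact: layer_next_inj|exact: layer_next_neq].
(* The terms are sorted by the size of the first moved set; [inord] loses nothing, as sizes are at
   most [#|K|]. *)
rewrite (partition_big (fun M : {ffun _ -> {set K}} =>
   inord #|M (ord0, false)| : 'I_#|K|.+1) predT) //=.
apply: eq_bigr => j _.
pose G t (S T : {set K}) :=
  if (#|S| == j) && (#|T| == j) then j`! * #|part_bij (b t) S T| else 0.
transitivity (\prod_t \sum_S \sum_T G t S T); last first.
  apply: eq_bigr => t _; rewrite /num_part_bij big_distrr [RHS]big_mkcond.
  apply: eq_bigr => S _; rewrite /G; case: ifP => _ /=; last by rewrite big1.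
  by rewrite big_distrr -big_mkcond.
rewrite -big_ffun_bool big_mkcond; apply: eq_bigr => M _.
have -> : \prod_i #|part_bij (layer_rel b i) (M i) (M (layer_next i))| =
  \prod_t (#|part_bij (b t) (M (t, false)) (M (t, true))| *
   #|part_bij (fun _ _ => true) (M (t, true)) (M (ordS t, false))|).
  transitivity (\prod_t \prod_c #|part_bij (layer_rel b (t, c)) (M (t, c))
     (M (layer_next (t, c)))|).
    by rewrite pair_bigA; apply: eq_bigr => -[].
  by apply: eq_bigr => t _; rewrite big_bool mulnC.
have inordE : (inord #|M (ord0, false)| == j) = (#|M (ord0, false)| == j).
  by rewrite -val_eqE /= inordK // ltnS max_card.
rewrite inordE.
have [/forallP all_j|/forallPn[t0 bad]] :=
   boolP [forall t, (#|M (t, false)| == j) && (#|M (t, true)| == j)].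
  have /andP[-> _] := all_j ord0.
  apply: eq_bigr => t _; rewrite /G all_j mulnC; congr (_ * _).
  have /andP[_ /eqP h1] := all_j t; have /andP[/eqP h2 _] := all_j (ordS t).
  by rewrite card_part_bij_full h1 h2 eqxx.
rewrite [RHS](bigD1 t0) //= /G (negPf bad) mul0n.
(* The first size is [j] but another one is not; a nonzero product would carry [j] around the whole
   cycle. *)
case: ifPn => // /eqP M0.
apply/eqP; rewrite -leqn0 leqNgt; apply: contra bad => prod_gt0.
have pos t : (#|M (t, false)| = #|M (t, true)|) /\ (#|M (t, true)| = #|M (ordS t, false)|).
  by move: prod_gt0; rewrite (bigD1 t) //= !muln_gt0 => /andP[/andP[]] /part_bij_card -> /part_bij_card ->.
suff Mt (m : nat) (lt_m : m < n.+1) : #|M (Ordinal lt_m, false)| = j.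
  have [<- _] := pos t0; case: t0 => m lt_m; by rewrite Mt eqxx.
elim: m lt_m => [|m IHm] lt_m.
  by rewrite -M0; congr (#|pred_of_set (M (_, _))|); apply: val_inj.
have lt_m' := ltnW lt_m.
have [e1 e2] := pos (Ordinal lt_m'); rewrite -(IHm lt_m') e1 e2.
congr (#|pred_of_set (M (_, _))|); apply: val_inj; by rewrite /= modn_small.
Qed.

Lemma num_derangements_layer (n : nat) (K : finType) (b : 'I_n.+1 -> rel K) :
  num_derangements (cyc_rel (@layer_next n) (layer_rel b)) =
  \prod_t (#|K|`! * num_part_bij (b t) #|K|).
Proof.
rewrite num_derangements_cyc; [|exact: layer_next_inj|exact: layer_next_neq].
have full (S : {set K}) : (#|S| == #|K|) = (S == setT).
  by rewrite -cardsT eqEcard subsetT /= eqn_leq subset_leq_card ?subsetT.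
transitivity (\prod_t \prod_c #|part_bij (layer_rel b (t, c)) setT setT|).
  by rewrite pair_bigA; apply: eq_bigr => -[].
apply: eq_bigr => t _; rewrite big_bool /= card_part_bij_full eqxx cardsT.
by rewrite /num_part_bij (eq_bigl _ _ full) big_pred1_eq (eq_bigl _ _ full) big_pred1_eq.
Qed.

(** * Number of partial bijections of a given size *)

Lemma num_part_bij_full (K : finType) (j : nat) :
  num_part_bij (fun _ _ : K => true) j = 'C(#|K|, j) * ('C(#|K|, j) * j`!).
Proof.
have cnt : \sum_(S : {set K} | #|S| == j) 1 = 'C(#|K|, j).
  by rewrite sum1_card -card_draws; apply: eq_card => S; rewrite !inE.
rewrite /num_part_bij -{1}cnt big_distrl; apply: eq_bigr => S /eqP Sj.
rewrite /= mul1n -cnt big_distrl /=; apply: eq_bigr => T /eqP Tj.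
by rewrite card_part_bij_full Sj Tj eqxx mul1n.
Qed.

Lemma num_part_bij_avoid_le (K : finType) (z : K) (j : nat) :
  num_part_bij (avoid z) j <= num_part_bij (fun _ _ : K => true) j.
Proof.
apply: leq_sum => S _; apply: leq_sum => T _.
by rewrite -(card_part_bij_avoid z) leq_addr.
Qed.

(** Without the missing pair [(z, z)], a bijection that uses it becomes one of size [j] between sets
    avoiding [z]; the binomials choose these two sets. *)
Lemma num_part_bij_avoid (K : finType) (z : K) (j : nat) :
  num_part_bij (avoid z) j.+1 + 'C(#|K|.-1, j) * ('C(#|K|.-1, j) * j`!) =
  num_part_bij (fun _ _ : K => true) j.+1.
Proof.
have cnt : \sum_(S : {set K} | #|S| == j.+1) (z \in S) = 'C(#|K|.-1, j).
  have K_gt0 : 0 < #|K| by apply/card_gt0P; exists z.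
  (* Pascal's rule: the added binomial counts the sets of size [j.+1] without [z]. *)
  apply: (@addnI 'C(#|K|.-1, j.+1)); rewrite -binS prednK // -card_draws.
  rewrite -(cardsC1 z) -cards_draws.
  rewrite -!sum1_card [RHS](bigID (fun S : {set K} => z \in S)) /= addnC.
  congr (_ + _).
    rewrite -big_mkcondr /=; apply: eq_bigl => S; by rewrite inE.
  apply: eq_bigl => S; rewrite !inE andbC; congr (_ && _).
  by rewrite -disjoints_subset disjoint_sym disjoints1.
rewrite -{1}cnt big_distrl -big_split /=; apply: eq_bigr => S /eqP Sj.
rewrite -cnt big_distrl big_distrr -big_split /=; apply: eq_bigr => T /eqP Tj.
rewrite -(card_part_bij_avoid z) card_part_bij_full; congr (_ + _).
case: ifP => [/andP[zS zT]|]; last by case: (z \in S); case: (z \in T); rewrite ?muln0.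
have := cardsD1 z S; have := cardsD1 z T; rewrite zS zT Sj Tj !add1n => -[eT] [eS]; rewrite -eS -eT.
by rewrite eqxx !mul1n.
Qed.

(** * Transport to an ordinal vertex type, by conjugation with an enumeration *)

Lemma relabel_ord (T : finType) (E : rel T) :
  0 < #|T| -> loopless E ->
  exists n (E' : rel 'I_n.+1), [/\ loopless E', num_perms E' = num_perms E
    & num_derangements E' = num_derangements E].
Proof.
move=> T_gt0 E_loopless; case cardT: #|T| T_gt0 => [//|n] _.
pose h (x : T) : 'I_n.+1 := cast_ord cardT (enum_rank x).
pose h' (i : 'I_n.+1) : T := enum_val (cast_ord (esym cardT) i).
have hK : cancel h h' by move=> x; rewrite /h /h' cast_ordK enum_rankK.
have h'K : cancel h' h by move=> x; rewrite /h /h' enum_valK cast_ordKV.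
pose E' : rel 'I_n.+1 := fun i j => E (h' i) (h' j).
have conj_inj (f : {perm 'I_n.+1}) : injective (fun x => h' (f (h x))).
  by move=> x y /(can_inj h'K) /perm_inj /(can_inj hK).
pose phi f := perm (conj_inj f).
have phi_inj : injective phi.
  move=> f g e; apply/permP => i; apply: (can_inj h'K).
  by have := congr1 (fun f : {perm T} => f (h' i)) e; rewrite !permE h'K.
have phi_surj g : exists f, g = phi f.
  have inj : injective (fun i => h (g (h' i))).
    by move=> x y /(can_inj hK) /perm_inj /(can_inj h'K).
  by exists (perm inj); apply/permP => x; rewrite !permE !hK.
have forallh (P : pred T) (Q : pred 'I_n.+1) : (forall i, P (h' i) = Q i) ->
    [forall x, P x] = [forall i, Q i].
  move=> PQ; apply/forallP/forallP => [p i|q x]; first by rewrite -PQ.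
  by rewrite -(hK x) PQ.
have permE' f : is_graph_perm E (phi f) = is_graph_perm E' f.
  by apply: forallh => i; rewrite permE h'K (inj_eq (can_inj h'K)).
have derE' f : is_graph_derangement E (phi f) = is_graph_derangement E' f.
  rewrite /is_graph_derangement permE'; congr (_ && _).
  by apply: forallh => i; rewrite permE h'K (inj_eq (can_inj h'K)).
have cardE (P : pred {perm T}) (Q : pred {perm 'I_n.+1}) :
    (forall f, P (phi f) = Q f) -> #|[set f | Q f]| = #|[set g | P g]|.
  move=> PQ; rewrite -(card_imset _ phi_inj); apply: eq_card => g; rewrite inE.
  apply/imsetP/idP => [[f]|Pg]; first by rewrite inE -PQ => ? ->.
  by have [f gE] := phi_surj g; exists f => //; rewrite inE -PQ -gE.
exists n, E'; split; [by move=> v; apply: E_loopless|exact: cardE permE'|exact: cardE derE'].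
Qed.

(** * Weights of pairs of transitions, with [k = q.+2] vertices per layer *)

Section Weights.
Variable q : nat.
(** [full j] and [avd j] are the factors contributed by one pair when [j] vertices per layer move;
    the factorial comes from the complete second transition. *)
Let full (j : nat) := j`! * num_part_bij (fun _ _ : 'I_q.+2 => true) j.
Let avd (j : nat) := j`! * num_part_bij (avoid (ord0 : 'I_q.+2)) j.

Lemma full_weightE j : full j = (q.+2 ^_ j) ^ 2.
Proof. by rewrite /full num_part_bij_full card_ord -bin_ffact -mulnn; ring. Qed.

Lemma full_weight_top : full q.+2 = (q.+2)`! ^ 2.
Proof. by rewrite full_weightE ffactnn. Qed.

(** The falling factorials of [k] of lengths [k - 1] and [k] differ by a factor 1. *)
Lemma full_weight_subtop : full q.+1 = (q.+2)`! ^ 2.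
Proof. by rewrite full_weightE -(ffact_fact (leqnSn q.+1)) subSnn muln1. Qed.

(** Of the [k!] bijections, [(k-1)!] use the missing edge; the complete transition multiplies the
    rest by [k!]. *)
Lemma avoid_weight_top : avd q.+2 = q.+2 * q.+1 * (q.+1)`! ^ 2.
Proof.
apply/eqP; rewrite -(eqn_add2r ((q.+2)`! * (q.+1)`!)); apply/eqP.
transitivity (full q.+2); last by rewrite full_weight_top factS; ring.
by rewrite /full -(num_part_bij_avoid ord0) card_ord binn mulnDr !mul1n.
Qed.

(** In units of the square of [(k-1)!], the missing edge costs [k - 1] out of [k^2]. Against the top
    weight this gives the ratio [1 + 1/(k(k-1))]. *)
Lemma avoid_weight_subtop :
  avd q.+1 = (q.+2 * q.+1 + 1) * (q.+1)`! ^ 2.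
Proof.
apply/eqP; rewrite -(eqn_add2r (q.+1 * (q.+1)`! ^ 2)); apply/eqP.
transitivity (full q.+1); last by rewrite full_weight_subtop factS; ring.
rewrite /full -(num_part_bij_avoid ord0) card_ord binSn mulnDr; congr (_ + _).
by rewrite [(q.+1)`!]factS; ring.
Qed.

Lemma avoid_weight_le j : avd j <= full j.
Proof. by rewrite leq_mul2l num_part_bij_avoid_le orbT. Qed.

(** The falling factorial is [k!/(k-j)!] with [(k-j)!] at least 2; squaring gives the 4. *)
Lemma full_weight_small j : j <= q -> 4 * full j <= full q.+2.
Proof.
move=> le_jq; rewrite full_weight_top full_weightE (_ : 4 = 2 ^ 2) // -expnMn leq_exp2r //.
rewrite -(@ffact_fact q.+2 j) 1?mulnC ?leq_mul2l; last by lia.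
apply/orP; right; have -> : q.+2 - j = (q - j).+2 by lia.
by rewrite factS (leq_trans _ (leq_pmulr _ (fact_gt0 _))).
Qed.

(** The defect multiplies the top weight by [(k-1)/k], which is at least 1/2, so a factor 2 of the 4
    survives. *)
Lemma avoid_weight_small j : j <= q -> 2 * avd j <= avd q.+2.
Proof.
move=> /full_weight_small; have := avoid_weight_le j.
rewrite full_weight_top avoid_weight_top factS; nia.
Qed.

(** The first [m] pairs are defective and the other [l.+1] complete. *)
Lemma layered_counts (m l : nat) :
  exists n (E : rel 'I_n.+1) , loopless E /\ forall R : numFieldType,
  dp_ratio R E = ((avd q.+2 ^ m * full q.+2 ^ l.+1)%:R /
    (\sum_(j < q.+3) avd j ^ m * full j ^ l.+1)%:R)%R.
Proof.
pose b (t : 'I_(m + l).+1) : rel 'I_q.+2 := if t < m then avoid ord0 else fun _ _ => true.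
pose E := cyc_rel (@layer_next (m + l)) (layer_rel b).
have E_loopless : loopless E.
  by move=> v; rewrite /E /cyc_rel eq_sym (negPf (layer_next_neq _)).
have prodE j : \prod_t (j`! * num_part_bij (b t) j) = avd j ^ m * full j ^ l.+1.
  rewrite (eq_bigr (fun t : 'I__ => if t < m then avd j else full j)); last first.
    by move=> t _; rewrite /b; case: ifP.
  rewrite -(big_mkord xpredT (fun t => if t < m then avd j else full j)).
  rewrite (@big_cat_nat _ _ _ m) //=; last by rewrite -addnS leq_addr.
  congr (_ * _).
    rewrite big_nat (eq_bigr (fun=> avd j)) => [|t /andP[_ ->] //].
    by rewrite -big_nat prod_nat_const_nat subn0.
  rewrite big_nat (eq_bigr (fun=> full j)) => [|t /andP[]]; last by rewrite leqNgt => /negPf ->.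
  by rewrite -big_nat prod_nat_const_nat -addnS addKn.
have [|n [E' [E'_loopless pE' dE']]] := relabel_ord _ E_loopless.
  by rewrite !card_prod !card_ord card_bool.
exists n, E'; split=> // R; rewrite /dp_ratio pE' dE'.
rewrite num_perms_layer num_derangements_layer !card_ord !prodE.
by congr (_ / _%:R)%R; apply: eq_bigr => j _; rewrite prodE.
Qed.

Local Open Scope ring_scope.

(** Everything is divided by the term [j = k]. The term [j = k - 1] becomes the [m]-th power, since
    complete pairs weigh the same there, and the [q.+1] smaller terms make up [d]. *)
Lemma layered_ratio (R : realFieldType) (m l : nat) :
  exists n (E : rel 'I_n.+1) (d : R), [/\ loopless E, 0 <= d, d <= q.+1%:R / 2 ^+ l &
    dp_ratio R E = (1 + (1 + (q.+2 * q.+1)%:R^-1) ^+ m + d)^-1].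
Proof.
have [n [E [E_loopless EE]]] := layered_counts m l.
pose D : R := (avd q.+2 ^ m * full q.+2 ^ l.+1)%:R.
pose A (j : nat) : R := (avd j ^ m * full j ^ l.+1)%:R / D.
pose d := \sum_(j < q.+1) A j.
have D_gt0 : 0 < D.
  by rewrite ltr0n muln_gt0 !expn_gt0 avoid_weight_top full_weight_top
    !muln_gt0 !fact_gt0.
have A_ge0 j : 0 <= A j by rewrite divr_ge0 ?ler0n.
(* The decay is taken from the complete pairs; the defective factors are only bounded by their top
   value. *)
have A_le (j : 'I_q.+1) : A j <= 1 / 2 ^+ l.
  rewrite /A ler_pdivrMr // mul1r mulrC ler_pdivlMr ?exprn_gt0 ?ltr0n //.
  rewrite -natrX -natrM ler_nat.
  have le_jq : (j <= q)%N by rewrite -ltnS.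
  have le_exp a b e : (a <= b)%N -> (a ^ e <= b ^ e)%N.
    by case: e => // e; rewrite leq_exp2r.
  rewrite -mulnA leq_mul ?le_exp //.
    by apply: leq_trans (avoid_weight_small le_jq); rewrite leq_pmull.
  have le4 := full_weight_small le_jq.
  rewrite !expnS -mulnA -expnMn leq_mul ?le_exp //; apply: leq_trans le4.
    by rewrite leq_pmull.
  by rewrite mulnC leq_mul2r orbT.
exists n, E, d; split => //.
- by apply: sumr_ge0 => j _.
- have := @ler_sum R _ (index_enum 'I_q.+1) predT (fun j => A j) (fun=> 1 / 2 ^+ l) (fun j _ => A_le j).
  by rewrite sumr_const card_ord -[_ *+ _]mulr_natl div1r.
rewrite EE -/D -[LHS]invrK; congr (_^-1).
rewrite invf_div natr_sum mulr_suml.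
rewrite (eq_bigr (fun j : 'I__ => A j)) //.
have -> : \sum_(j < q.+3) A j = d + A q.+1 + A q.+2 by rewrite 2!big_ord_recr.
have -> : A q.+2 = 1 by rewrite /A divff // gt_eqF.
have -> : A q.+1 = (1 + (q.+2 * q.+1)%:R^-1) ^+ m; last by rewrite addrC [d + _]addrC addrA.
rewrite /A /D full_weight_subtop full_weight_top !natrM.
rewrite -mulf_div divff ?mulr1; last by rewrite pnatr_eq0 -lt0n !expn_gt0 fact_gt0.
rewrite !natrX -expr_div_n avoid_weight_top avoid_weight_subtop; congr (_ ^+ _).
rewrite [in LHS]natrM [in X in _ / X]natrM natrD.
by field; rewrite nat1r -natrD !pnatr_eq0 -!lt0n fact_gt0.
Qed.

End Weights.

(** * Real estimates for the limit values *)

Local Open Scope ring_scope.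

Lemma bernoulli (R : realFieldType) (h : R) (m : nat) :
  0 <= h -> 1 + m%:R * h <= (1 + h) ^+ m.
Proof.
move=> h_ge0; elim: m => [|m IHm]; first by rewrite mul0r addr0.
rewrite exprS -natr1; have := @ler_wpM2l _ (1 + h) _ _ _ IHm.
have := mulr_ge0 (ler0n R m) (mulr_ge0 h_ge0 h_ge0); nra.
Qed.

(** The decrease is [h * x] over the product of the two denominators, which is at least [x]. This
    bounds the step from exponent [m] to [m.+1]. *)
Lemma inv_step_le (R : realFieldType) (x h : R) :
  1 <= x -> 0 <= h -> (1 + x)^-1 - h <= (1 + (1 + h) * x)^-1.
Proof.
move=> x_ge1 h_ge0; have hx := mulr_ge0 h_ge0 (le_trans ler01 x_ge1).
rewrite lerBlDr -subr_ge0.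
have -> : (1 + (1 + h) * x)^-1 + h - (1 + x)^-1 =
    h * ((1 + x) * (1 + (1 + h) * x) - x) / ((1 + x) * (1 + (1 + h) * x)).
  by field; apply/andP; split; apply: lt0r_neq0; nra.
apply: divr_ge0; last by apply: mulr_ge0; nra.
by apply: mulr_ge0 => //; nra.
Qed.

(** The difference is [d / (x * (x + d))], with denominator at least 1. *)
Lemma inv_perturb_le (R : realFieldType) (x d : R) :
  1 <= x -> 0 <= d -> `|(x + d)^-1 - x^-1| <= d.
Proof.
move=> x_ge1 d_ge0; rewrite ler0_norm; last first.
  by rewrite subr_le0 lef_pV2 ?posrE; lra.
rewrite opprB -subr_ge0.
have -> : d - (x^-1 - (x + d)^-1) = d * (x * (x + d) - 1) / (x * (x + d)).
  by field; apply/andP; split; apply: lt0r_neq0; lra.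
apply: divr_ge0; last by nra.
by apply: mulr_ge0 => //; nra.
Qed.

(** The values start at 1/2, tend to 0 and drop by at most [h <= e] per step, so the first one below
    [r + e] is still at least [r]. *)
Lemma approx_inv_pow (R : archiRealFieldType) (r e h : R) :
  0 <= r -> r <= 1 / 2 -> 0 < h -> h <= e ->
  exists m, `|(1 + (1 + h) ^+ m)^-1 - r| < e.
Proof.
move=> r_ge0 r_le h_gt0 h_le; have e_gt0 := lt_le_trans h_gt0 h_le.
pose a m := (1 + (1 + h) ^+ m)^-1.
have ex_m : exists m, a m < r + e.
  (* For such [m], Bernoulli's inequality gives [(1 + h) ^+ m > e^-1]. *)
  have [m m_gt] : exists m, e^-1 * h^-1 < m%:R.
    by exists (Num.bound (e^-1 * h^-1)); rewrite archi_boundP ?mulr_ge0 ?invr_ge0 ?ltW.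
  exists m; suff : a m < e by lra.
  have := bernoulli m (ltW h_gt0).
  rewrite ltr_pdivrMr // in m_gt.
  rewrite /a invf_plt ?posrE ?addr_gt0 ?exprn_gt0 //; lra.
case: (ex_minnP ex_m) => -[|m] am_lt m_min.
  exists 0%N; move: am_lt; rewrite /a expr0 (_ : (1 + 1)^-1 = 1 / 2); last by field.
  by move=> am_lt; rewrite ltr_norml; apply/andP; split; lra.
exists m.+1; rewrite -/(a _).
have : r + e <= a m by rewrite leNgt; apply/negP => /m_min; rewrite ltnn.
have : a m - h <= a m.+1.
  rewrite /a exprS; apply: inv_step_le (ltW h_gt0).
  by apply: exprn_ege1; lra.
by move=> h1 h2; rewrite ltr_norml; apply/andP; split; lra.
Qed.

Unset Implicit Arguments.

Theorem mainTheorem1 (R : realType) (r eps : R) :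
  0 <= r -> r <= 1 / 2 -> 0 < eps ->
  exists (n : nat) (E : rel 'I_n.+1),
    loopless E /\ `| dp_ratio R E - r | < eps.
Proof.
(* Half of [eps] is for the distance from [r] to the limit value, half for the remainder [d]. *)
move=> r_ge0 r_le eps_gt0; pose e := eps / 2.
have e_gt0 : 0 < e by rewrite /e; lra.
pose q := Num.bound e^-1; pose h : R := (q.+2 * q.+1)%:R^-1.
have h_gt0 : 0 < h by rewrite invr_gt0 ltr0n.
have h_le : h <= e.
  rewrite invf_ple ?posrE ?ltr0n //; apply: ltW.
  apply: lt_le_trans (archi_boundP _) _; first by rewrite invr_ge0 ltW.
  by rewrite ler_nat -/q; nia.
have [m am] := approx_inv_pow r_ge0 r_le h_gt0 h_le.
(* This suffices because [l < 2 ^ l]. *)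
pose l := Num.bound (q.+1%:R / e).
have l_gt : q.+1%:R / 2 ^+ l < e.
  rewrite ltr_pdivrMr ?exprn_gt0 ?ltr0n // mulrC -ltr_pdivrMr //.
  apply: lt_le_trans (archi_boundP _) _; first by rewrite divr_ge0 ?ler0n ?ltW.
  by rewrite -natrX ler_nat -/l ltnW // ltn_expl.
have [n [E [d [E_loopless d_ge0 d_le EE]]]] := layered_ratio q R m l.
exists n, E; split=> //; rewrite EE -/h.
have x_ge1 : 1 <= 1 + (1 + h) ^+ m by rewrite lerDl exprn_ge0 //; lra.
have pert := inv_perturb_le x_ge1 d_ge0.
rewrite -(subrKA (1 + (1 + h) ^+ m)^-1); apply: le_lt_trans (ler_normD _ _) _.
by move: am pert; rewrite /e in l_gt *; lra.
Qed.
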